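(* Let $G_m$ be a bounded Vilenkin group. a) There exists an absolute constant $c$ (the sequence $m$ being fixed; $c$ does not depend on $f$) such that for every $f\in H_1$ $$\sup_{n\ge 2}\frac{1}{n\log n}\sum_{k=1}^{n}\|S_kf\|_1\le c\,\|f\|_{H_1}.$$ b) Let $\varphi:\mathbb{N}_+\to[1,\infty)$, $n\mapsto\varphi_n$, be a nondecreasing function satisfying $$\limsup_{n\to\infty}\frac{\log n}{\varphi_n}=+\infty .$$ Then there exists $f\in H_1$ such that $$\sup_{n\in\mathbb{N}_+}\frac{1}{n\varphi_n}\sum_{k=1}^{n}\|S_kf\|_1=\infty .$$
   Context: Let $m=(m_0,m_1,\ldots)$ be a fixed sequence of integers $m_k\ge 2$ with $\sup_k m_k<\infty$. $G_m=\prod_{k\ge0}Z_{m_k}$, $Z_{m_k}=\{0,\ldots,m_k-1\}$ the integers mod $m_k$, is the bounded Vilenkin group with product (of discrete) topology and normalized Haar measure $\mu$. $I_0(x)=G_m$, $I_n(x)=\{y\in G_m: y_0=x_0,\ldots,y_{n-1}=x_{n-1}\}$. $M_0=1$, $M_{k+1}=m_kM_k$; every $n\in\mathbb{N}$ is uniquely $n=\sum_j n_jM_j$ with $n_j\in Z_{m_j}$. $r_k(x)=\exp(2\pi i x_k/m_k)$ and $\psi_n=\prod_k r_k^{n_k}$ (Vilenkin system). $\mathbb{N}_+=\{1,2,\ldots\}$, $\mathbb{N}=\mathbb{N}_+\cup\{0\}$. For $f\in L_1(G_m)$: $\widehat f(n)=\int_{G_m} f\overline{\psi_n}\,d\mu$;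 $S_0f=0$, $S_nf=\sum_{k=0}^{n-1}\widehat f(k)\psi_k$. $\|g\|_p=(\int_{G_m}|g|^pd\mu)^{1/p}$. Let $\mathcal F_n$ be the $\sigma$-algebra generated by the sets $I_n(x)$, $x\in G_m$. A martingale is a sequence $f=(f^{(n)}:n\in\mathbb{N})$ of integrable functions with $f^{(n)}$ $\mathcal F_n$-measurable and $S_{M_n}f^{(l)}=f^{(n)}$ for $n\le l$ (i.e. $f^{(n)}$ is the conditional expectation of $f^{(l)}$). $f^*=\sup_n|f^{(n)}|$; $H_p$ ($0<p<\infty$) is the space of martingales with $\|f\|_{H_p}:=\|f^*\|_p<\infty$. For a martingale, $\widehat f(i)=\lim_{k\to\infty}\int_{G_m}f^{(k)}\overline{\psi_i}\,d\mu$ and $S_nf=\sum_{k=0}^{n-1}\widehat f(k)\psi_k$. A function $f\in L_1$ is identified with the martingale $(S_{M_n}f:n\in\mathbb{N})$. *)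

(* Defs.v *)
From HB Require Import structures.
From mathcomp Require Import all_boot all_order all_algebra.
From mathcomp Require Import all_classical all_reals all_analysis.
From mathcomp Require Import complex.

Set Implicit Arguments.
Unset Strict Implicit.
Unset Printing Implicit Defensive.

Import Order.TTheory GRing.Theory Num.Theory.
Import numFieldNormedType.Exports.

Local Open Scope classical_set_scope.
Local Open Scope ring_scope.
Local Open Scope complex_scope.

(* 'Z_k is the ring of integers mod k only for k >= 2, so everything below is
   meaningful under the assumption that 2 <= m k for all k. *)
Definition vilenkin (m : nat -> nat) : Type :=
  prod_topology (fun k => discrete_topology 'Z_(m k)).

HB.instance Definition _ (m : nat -> nat) := Topological.on (vilenkin m).
HB.instance Definition _ (m : nat -> nat) :=
  isPointed.Build (vilenkin m) (fun k => (0 : 'Z_(m k))).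
(* The Borel sigma-algebra. *)
HB.instance Definition _ (m : nat -> nat) :=
  Measurable.copy (vilenkin m) (g_sigma_algebraType (@open (vilenkin m))).

Section VilenkinSystem.
Context (R : realType) (m : nat -> nat).
Implicit Types (x y : vilenkin m) (k n : nat).

Definition coord x k : 'Z_(m k) := x k.

Definition vadd x y : vilenkin m := fun k => coord x k + coord y k.

(* The basic interval I_n(x). *)
Definition cylinder n x : set (vilenkin m) :=
  [set y | forall k, (k < n)%N -> coord y k = coord x k].

Definition Mprod k : nat := (\prod_(j < k) m j)%N.

(* n = \sum_k digit n k * Mprod k; as Mprod k >= 2 ^ k > k when all m j >= 2,
   digit n k = 0 for k >= n. *)
Definition digit n k : nat := ((n %/ Mprod k) %% m k)%N.

Definition rademacher k x : R[i] :=
  let t := 2 * pi * (coord x k : nat)%:R / (m k)%:R in cos t +i* sin t.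

(* The infinite product over k is truncated at k < n, where the omitted
   exponents vanish. *)
Definition psi n x : R[i] := \prod_(k < n) rademacher k x ^+ digit n k.

End VilenkinSystem.

(* A Borel probability measure on the (compact metrizable) group is its
   normalized Haar measure iff it is translation invariant. *)
Definition haar (R : realType) (m : nat -> nat)
    (mu : probability (vilenkin m) R) : Prop :=
  forall (x : vilenkin m) (A : set (vilenkin m)), measurable A ->
    mu [set vadd x y | y in A] = mu A.

Section Fourier.
Context (R : realType) (m : nat -> nat) (mu : probability (vilenkin m) R).
Implicit Types (g : vilenkin m -> R[i]) (f : nat -> vilenkin m -> R[i]).

Definition cintegrable g : Prop :=
  mu.-integrable setT (fun x => (complex.Re (g x))%:E) /\
  mu.-integrable setT (fun x => (complex.Im (g x))%:E).

Definition cintegral g : R[i] :=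
  (\int[mu]_x complex.Re (g x)) +i* (\int[mu]_x complex.Im (g x)).

Definition cmod (z : R[i]) : R := ComplexField.Normc.normc z.

Definition cnorm (p : \bar R) g : \bar R := Lnorm mu p (fun x => (cmod (g x))%:E).

Definition fourier g (n : nat) : R[i] :=
  cintegral (fun x => g x * (psi R n x)^*).

Definition psum g (n : nat) (x : vilenkin m) : R[i] :=
  \sum_(k < n) fourier g k * psi R k x.

Definition Fmeasurable (n : nat) g : Prop :=
  let T := g_sigma_algebraType (range (@cylinder m n)) in
  measurable_fun [set: T] (fun x : T => complex.Re (g x)) /\
  measurable_fun [set: T] (fun x : T => complex.Im (g x)).

Definition martingale f : Prop :=
  [/\ forall n, cintegrable (f n),
      forall n, Fmeasurable n (f n) &
      forall n l, (n <= l)%N -> psum (f l) (Mprod m n) =1 f n].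

Definition maximal f (x : vilenkin m) : \bar R :=
  ereal_sup [set (cmod (f n x))%:E | n in setT].

Definition Hnorm (p : \bar R) f : \bar R := Lnorm mu p (maximal f).

Definition hardy (p : \bar R) f : Prop :=
  martingale f /\ (Hnorm p f < +oo)%E.

Definition mfourier f (i : nat) : R[i] :=
  lim ((fun k => fourier (f k) i : R[i]^o) @ \oo).

Definition mpsum f (n : nat) (x : vilenkin m) : R[i] :=
  \sum_(k < n) mfourier f k * psi R k x.

End Fourier.

(* Main.v *)
(** Every martingale is a sequence of Vilenkin polynomials, hence of functions
constant on cylinders, so all integrals are finite averages over the points
[digit_point i], [i < M_n], that represent the cylinders of rank [n].

a) Splitting [[0, K)] along the digits of [K] writes [S_K] as a sum of
[O(log K)] blocks [psi_(c M_j) E_j (psi_(c M_j)^-1 f)], each an [L_1]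
contraction, and [||f^(N)||_1 <= ||f||_(H_1)].

b) Take [f = \sum_N lam_N psi_(M_N) D_(M_N)] with summable [lam_N >= 0]; then
[f^* <= \sum_N lam_N D_(M_N)] is integrable and, for [0 <= j < M_N],
[S_(M_N + j) f = f^(N) + lam_N psi_(M_N) D_j]. Averaging over the [N]-th
coordinate gives [||D_(q M_N + j)||_1 >= ||D_j||_1] for [q < m_N], with a gain
of [1 - j / M_N] when [q = 1]; hence the mean of [||D_j||_1] over [j < M_N] is
at least [c N]. It remains to concentrate the weights [lam_N] on levels where
[N / phi (2 M_N)] is large. *)

Require Import Defs.
From mathcomp Require Import all_boot all_order all_algebra.
From mathcomp Require Import all_classical all_reals all_analysis.
From mathcomp Require Import measurable_realfun complex zify ring lra.

Import Order.TTheory GRing.Theory Num.Theory.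
Import numFieldNormedType.Exports.

Local Open Scope classical_set_scope.
Local Open Scope complex_scope.
Local Open Scope ring_scope.

Set Implicit Arguments.
Unset Strict Implicit.
Unset Printing Implicit Defensive.

(** * Cutting a finite sum into consecutive blocks *)

Section BlockSum.
Variable V : zmodType.
Implicit Types F : nat -> V.

Lemma sum_ordD a b F :
  \sum_(i < a + b) F i = \sum_(i < a) F i + \sum_(i < b) F (a + i)%N.
Proof. by rewrite big_split_ord. Qed.

Lemma sum_blocks q n r F :
  \sum_(i < q * n + r) F i =
  \sum_(b < q) \sum_(i < n) F (b * n + i)%N + \sum_(i < r) F (q * n + i)%N.
Proof.
rewrite sum_ordD; congr (_ + _).
elim: q => [|q ih]; first by rewrite mul0n !big_ord0.
by rewrite mulSnr sum_ordD ih big_ord_recr.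
Qed.

End BlockSum.

(** * Mixed-radix expansion with respect to [M] *)

Section Digits.
Variable m : nat -> nat.
Hypothesis m_ge2 : forall k : nat, (2 <= m k)%N.
Local Notation M := (Mprod m).

Lemma m_gt0 k : (0 < m k)%N.
Proof. exact: leq_trans (m_ge2 k). Qed.

Lemma Mprod0 : M 0 = 1%N.
Proof. by rewrite /Mprod big_ord0. Qed.

Lemma MprodS k : M k.+1 = (M k * m k)%N.
Proof. by rewrite /Mprod big_ord_recr. Qed.

Lemma Mprod_gt0 k : (0 < M k)%N.
Proof. by elim: k => [|k ih]; rewrite ?Mprod0 // MprodS muln_gt0 ih m_gt0. Qed.

Lemma leq_expn2_Mprod k : (2 ^ k <= M k)%N.
Proof.
by elim: k => [|k ih]; rewrite ?Mprod0 // MprodS expnS mulnC leq_mul.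
Qed.

Lemma ltn_Mprod k : (k < M k)%N.
Proof. exact: leq_trans (ltn_expl k _) (leq_expn2_Mprod k). Qed.

Lemma dvdn_Mprod j k : (j <= k)%N -> (M j %| M k)%N.
Proof.
elim: k => [|k ih]; first by rewrite leqn0 => /eqP ->.
rewrite leq_eqVlt => /predU1P[->//|]; rewrite ltnS => /ih /dvdn_trans -> //.
by rewrite MprodS dvdn_mulr.
Qed.

Lemma leq_Mprod j k : (j <= k)%N -> (M j <= M k)%N.
Proof. by move=> jk; rewrite dvdn_leq ?Mprod_gt0 ?dvdn_Mprod. Qed.

Lemma double_Mprod_leq k : (2 * M k <= M k.+1)%N.
Proof. by rewrite MprodS mulnC leq_mul. Qed.

Lemma sum_MprodS (V : zmodType) k (F : nat -> V) :
  \sum_(i < M k.+1) F i = \sum_(a < m k) \sum_(i < M k) F (a * M k + i)%N.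
Proof. by rewrite MprodS mulnC -[(_ * _)%N]addn0 sum_blocks big_ord0 addr0. Qed.

Lemma digit_lt i k : (digit m i k < m k)%N.
Proof. by rewrite ltn_mod m_gt0. Qed.

Lemma digit_small i k : (i < M k)%N -> digit m i k = 0%N.
Proof. by move=> ik; rewrite /digit divn_small ?mod0n. Qed.

(** No carry occurs: [c * M j] has zero digits below [j], while [i] has zero digits from [j] on. *)
Lemma digitD c j i k : (i < M j)%N ->
  digit m (c * M j + i) k = (digit m (c * M j) k + digit m i k)%N.
Proof.
move=> ij; have [kj|jk] := ltnP k j.
  have /dvdnP[e Me] := dvdn_Mprod kj.
  have {}Me : M j = (e * m k * M k)%N by rewrite Me MprodS [(M k * _)%N]mulnC mulnA.
  by rewrite /digit Me mulnA divnMDl ?Mprod_gt0 // mulnK ?Mprod_gt0 // !mulnA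
    modnMDl modnMl.
rewrite (@digit_small i) ?addn0; last exact: leq_trans ij (leq_Mprod jk).
have /dvdnP[e Me] := dvdn_Mprod jk.
rewrite /digit Me [(e * _)%N]mulnC !divnMA divnMDl ?Mprod_gt0 //.
by rewrite (divn_small ij) addn0 mulnK ?Mprod_gt0.
Qed.

Lemma digitM q n k : (q < m n)%N ->
  digit m (q * M n) k = if k == n then q else 0%N.
Proof.
move=> qn; case: eqVneq => [->|kn]; first by rewrite /digit mulnK ?Mprod_gt0 ?modn_small.
have [{}kn|nk] := ltnP k n.
  have /dvdnP[e Me] := dvdn_Mprod kn.
  by rewrite /digit Me MprodS [(M k * _)%N]mulnC !mulnA mulnK ?Mprod_gt0 ?modnMl.
rewrite digit_small //; apply: (@leq_trans (M n.+1)).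
  by rewrite MprodS mulnC ltn_pmul2l ?Mprod_gt0.
by apply: leq_Mprod; rewrite ltn_neqAle eq_sym kn.
Qed.

(** The quotient by [M n] is the top digit, and the remainder keeps the lower digits, so induction
    applies to the remainders. *)
Lemma digit_inj n i j : (i < M n)%N -> (j < M n)%N ->
  (forall k, (k < n)%N -> digit m i k = digit m j k) -> i = j.
Proof.
elim: n i j => [|n ih] i j; first by rewrite Mprod0 !ltnS !leqn0 => /eqP-> /eqP->.
rewrite MprodS => iM jM ij.
have md l k : (k < n)%N -> digit m (l %% M n) k = digit m l k.
  move=> kn; rewrite [in RHS](divn_eq l (M n)) digitD ?ltn_mod ?Mprod_gt0 //.
  have /dvdnP[e Me] := dvdn_Mprod kn.
  rewrite [X in (X + _)%N](_ : _ = 0%N) // /digit Me MprodS.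
  by rewrite [(M k * m k)%N]mulnC !mulnA mulnK ?Mprod_gt0 ?modnMl.
have top l : (l < M n * m n)%N -> (l %/ M n)%N = digit m l n.
  by move=> lM; rewrite /digit modn_small // ltn_divLR ?Mprod_gt0 // mulnC.
rewrite (divn_eq i (M n)) (divn_eq j (M n)) !top // ij //.
by congr (_ + _)%N; apply: ih; rewrite ?ltn_mod ?Mprod_gt0 // => k kn; rewrite !md // ij // ltnW.
Qed.

Lemma digit_surj n (d : nat -> nat) : (forall k, (d k < m k)%N) ->
  exists2 i, (i < M n)%N & forall k, (k < n)%N -> digit m i k = d k.
Proof.
move=> dm; elim: n => [|n [i iM id]]; first by exists 0%N; rewrite ?Mprod0.
exists (d n * M n + i)%N.
  rewrite MprodS mulnC; apply: (@leq_trans ((d n).+1 * M n)).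
    by rewrite mulSn addnC mulnC ltn_add2r.
  by rewrite mulnC leq_mul.
move=> k; rewrite ltnS leq_eqVlt digitD // digitM //.
move=> /predU1P[->|kn]; first by rewrite eqxx digit_small ?addn0.
by rewrite ltn_eqF // id.
Qed.

Lemma Mprod_bracket n : (0 < n)%N -> exists N, (M N <= n < M N.+1)%N.
Proof.
elim: n => // -[_ _|n /(_ isT)[N /andP[lo hi]] _].
  by exists 0%N; rewrite MprodS !Mprod0 mul1n m_ge2.
have [hi'|] := ltnP n.+2 (M N.+1); first by exists N; rewrite hi' (leq_trans lo) ?leqnSn.
move=> hi'; exists N.+1; rewrite hi' /= MprodS.
have -> : M N.+1 = n.+2 by apply/eqP; rewrite eqn_leq hi' hi.
by rewrite ltn_Pmulr.
Qed.

End Digits.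

(** * The complex modulus and the unit circle *)

Section Modulus.
Variable R : realType.
Implicit Types z w : R[i].

Lemma normr_cmod z : `|z| = (cmod z)%:C.
Proof. by case: z. Qed.

Lemma cmod_ge0 z : 0 <= cmod z.
Proof. by case: z => a b; exact: sqrtr_ge0. Qed.

Lemma cmodM z w : cmod (z * w) = cmod z * cmod w.
Proof. exact: ComplexField.Normc.normcM. Qed.

Lemma cmod_conj z : cmod z^* = cmod z.
Proof. by case: z => a b; rewrite /cmod /= sqrrN. Qed.

Lemma cmod_real (r : R) : cmod r%:C = `|r|.
Proof. by rewrite /cmod /= expr0n addr0 sqrtr_sqr. Qed.

Lemma cmod0 : cmod (0 : R[i]) = 0.
Proof. exact: ComplexField.Normc.normc0. Qed.

Lemma cmod1 : cmod (1 : R[i]) = 1.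
Proof. exact: ComplexField.Normc.normc1. Qed.

Lemma cmod_nat n : cmod (n%:R : R[i]) = n%:R.
Proof. by rewrite -(rmorph_nat (real_complex R)) cmod_real normr_nat. Qed.

Lemma ler_cmodD z w : cmod (z + w) <= cmod z + cmod w.
Proof. by rewrite -lecR rmorphD /= -!normr_cmod ler_normD. Qed.

Lemma cmodN z : cmod (- z) = cmod z.
Proof. by case: z => a b; rewrite /cmod /= !sqrrN. Qed.

Lemma ler_cmodBD z w : cmod z - cmod w <= cmod (z + w).
Proof.
rewrite lerBlDr; have := ler_cmodD (z + w) (- w).
by rewrite addrK cmodN.
Qed.

Lemma ler_cmod_sum I (s : seq I) (P : pred I) (F : I -> R[i]) :
  cmod (\sum_(i <- s | P i) F i) <= \sum_(i <- s | P i) cmod (F i).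
Proof.
elim/big_rec2: _ => [|i y z _ h]; first by rewrite cmod0.
by apply: le_trans (ler_cmodD _ _) _; rewrite lerD2l.
Qed.

Definition cis (t : R) : R[i] := cos t +i* sin t.

Lemma cisD s t : cis (s + t) = cis s * cis t.
Proof.
by apply/eqP; rewrite eq_complex /= sinD cosD; apply/andP; split; apply/eqP; ring.
Qed.

Lemma cis0 : cis 0 = 1.
Proof. by rewrite /cis cos0 sin0. Qed.

Lemma conj_cis t : (cis t)^* = cis (- t).
Proof. by rewrite /cis cosN sinN. Qed.

Lemma cisX t n : cis t ^+ n = cis (n%:R * t).
Proof.
elim: n => [|n ih]; first by rewrite mul0r cis0.
by rewrite exprS ih -cisD -[n.+1]addn1 natrD mulrDl mul1r addrC.
Qed.

Lemma cis2pi : cis (2 * pi) = 1.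
Proof. by rewrite /cis mulr_natl cos2pi mulr2n sinD sinpi mul0r mulr0 addr0. Qed.

(** Since cos t = 1 - 2 sin^2 (t / 2), the real part is below 1 as soon as t / 2 lies strictly
    between 0 and pi. *)
Lemma cis_eq1 t : 0 <= t -> t < 2 * pi -> cis t = 1 -> t = 0.
Proof.
rewrite le_eqVlt => /predU1P[<-//|t0] t2 /(congr1 (@complex.Re R)) /= ct.
have s0 : 0 < sin (t / 2) by apply: sin_gt0_pi; lra.
have := cosD (t / 2) (t / 2); rewrite -splitr ct.
have := cos2Dsin2 (t / 2); nra.
Qed.

End Modulus.

(** * Vilenkin characters and their kernel identity *)

Section System.
Variables (R : realType) (m : nat -> nat).
Hypothesis m_ge2 : forall k : nat, (2 <= m k)%N.
Local Notation M := (Mprod m).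
Local Notation G := (vilenkin m).
Local Notation coord := Defs.coord.
Implicit Types x t : G.

Lemma coord_lt x k : (coord x k < m k)%N.
Proof. by apply: leq_trans (ltn_ord (coord x k)) _; rewrite Zp_cast. Qed.

Lemma rademacherE k x :
  rademacher R k x = cis ((coord x k : nat)%:R * (2 * pi / (m k)%:R)).
Proof. by rewrite /rademacher -/(cis _); congr cis; rewrite mulrCA !mulrA. Qed.

Lemma rademacher_exp k x : rademacher R k x ^+ m k = 1.
Proof.
have mk : (m k)%:R != 0 :> R by rewrite pnatr_eq0 -lt0n m_gt0.
rewrite rademacherE cisX mulrCA [(m k)%:R * _]mulrC divfK //.
by rewrite -cisX cis2pi expr1n.
Qed.

Lemma rademacher_conj k x : rademacher R k x * (rademacher R k x)^* = 1.
Proof. by rewrite rademacherE conj_cis -cisD subrr cis0. Qed.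

Lemma cmod_rademacher k x : cmod (rademacher R k x) = 1.
Proof. by rewrite rademacherE /cmod /= cos2Dsin2 sqrtr1. Qed.

Lemma rademacher_inj k x t :
  rademacher R k x = rademacher R k t -> coord x k = coord t k.
Proof.
have m0 : 0 < (m k)%:R :> R by rewrite ltr0n m_gt0.
suff key (a b : nat) : (a <= b < m k)%N ->
    cis (a%:R * (2 * pi / (m k)%:R)) = cis (b%:R * (2 * pi / (m k)%:R)) :> R[i] ->
    a = b.
  rewrite !rademacherE => e; apply/val_inj => /=.
  have [ab|/ltnW ba] := leqP (coord x k) (coord t k).
    by apply: key e; rewrite ab coord_lt.
  by apply/esym; apply: key (esym e); rewrite ba coord_lt.
move=> /andP[ab bm] e.
have th0 : 0 < 2 * pi / (m k)%:R :> R by rewrite divr_gt0 // mulr_gt0 // pi_gt0.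
(* The difference of the two angles lies in [0, 2 pi), where [cis_eq1] applies. *)
suff : (b - a)%:R * (2 * pi / (m k)%:R) = 0 :> R.
  move/eqP; rewrite mulf_eq0 (gt_eqF th0) orbF pnatr_eq0 subn_eq0 => ba.
  by apply/eqP; rewrite eqn_leq ab.
apply: cis_eq1; first by rewrite mulr_ge0 // ltW.
- rewrite mulrCA gtr_pMr; last by rewrite mulr_gt0 // pi_gt0.
  by rewrite ltr_pdivrMr // mul1r ltr_nat; lia.
- rewrite natrB // mulrBl cisD -e -conj_cis.
  by rewrite conj_cis -cisD subrr cis0.
Qed.

(** When the coordinates differ, the ratio is an [m k]-th root of unity other than 1, so the
    geometric sum over a full period vanishes. *)
Lemma rademacher_geom k x t :
  \sum_(a < m k) (rademacher R k x * (rademacher R k t)^*) ^+ a =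
  if coord x k == coord t k then (m k)%:R else 0.
Proof.
set w := _ * _; case: eqP => [e|ne].
  have -> : w = 1.
    rewrite /w (_ : rademacher R k x = rademacher R k t) ?rademacher_conj //.
    by rewrite /rademacher e.
  by rewrite (eq_bigr (fun=> 1)) ?sumr_const ?card_ord // => i _; rewrite expr1n.
have w1 : w - 1 != 0.
  rewrite subr_eq0; apply/eqP => w1; apply: ne; apply: (@rademacher_inj k).
  by rewrite -[LHS]mulr1 -(rademacher_conj k t) [rademacher R k t * _]mulrC mulrA -/w w1 mul1r.
apply: (mulfI w1); rewrite -subrX1 mulr0 /w exprMn rademacher_exp -rmorphXn.
by rewrite rademacher_exp rmorph1 mulr1 subrr.
Qed.

(** Frees [psi] from its own truncation: all digits of [n] from [K] on vanish, so characters of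
    different index can be compared over a common range of coordinates. *)
Lemma psi_wide K n x : (n < M K)%N ->
  psi R n x = \prod_(k < K) rademacher R k x ^+ digit m n k.
Proof.
have wide J L : (J <= L)%N -> (n < M J)%N ->
    \prod_(k < L) rademacher R k x ^+ digit m n k =
    \prod_(k < J) rademacher R k x ^+ digit m n k.
  move=> JL nJ; rewrite -!(big_mkord predT (fun k => rademacher R k x ^+ digit m n k)).
  rewrite (big_cat_nat _ (n := J)) //= -[RHS]mulr1; congr (_ * _).
  rewrite big_nat_cond big1 // => k.
  rewrite andbT => /andP[Jk _]; rewrite digit_small //.
  exact: leq_trans nJ (leq_Mprod m_ge2 Jk).
move=> nK; have [nK'|/ltnW Kn] := leqP n K; last exact: wide.
by rewrite (@wide n) // ltn_Mprod.
Qed.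

Lemma psi0 x : psi R 0 x = 1.
Proof. by rewrite /psi big_ord0. Qed.

Lemma psiD c j i x : (i < M j)%N ->
  psi R (c * M j + i) x = psi R (c * M j) x * psi R i x.
Proof.
move=> ij; set n := (_ + _)%N.
have nM l : (l <= n)%N -> (l < M n)%N.
  by move=> /leq_ltn_trans; apply; exact: ltn_Mprod.
rewrite !(@psi_wide n) ?nM ?leq_addl ?leq_addr // -big_split /=.
by apply: eq_bigr => k _; rewrite digitD // exprD.
Qed.

Lemma psiM q n x : (q < m n)%N -> psi R (q * M n) x = rademacher R n x ^+ q.
Proof.
move=> qn; rewrite (@psi_wide n.+1); last first.
  by rewrite MprodS mulnC ltn_pmul2l ?Mprod_gt0.
rewrite big_ord_recr /= digitM // eqxx big1 ?mul1r // => k _.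
by rewrite digitM // ltn_eqF.
Qed.

Lemma cmod_psi n x : cmod (psi R n x) = 1.
Proof.
rewrite /psi; elim/big_rec: _ => [|k z _ h]; first exact: cmod1.
rewrite cmodM h mulr1; elim: (digit _ _ _) => [|d ih]; first by rewrite expr0 cmod1.
by rewrite exprS cmodM ih cmod_rademacher mulr1.
Qed.

Lemma psi_cyl n k x t : (k < M n)%N -> cylinder n x t -> psi R k t = psi R k x.
Proof.
move=> kM xt; rewrite !(@psi_wide n) //; apply: eq_bigr => i _.
by rewrite /rademacher xt.
Qed.

(** This is the Dirichlet kernel of order [M n] at x - t. Separating the leading digit of the index
    factors it into the geometric sums of [rademacher_geom], one for each coordinate below [n]. *)
Lemma psi_kernel n x t :
  \sum_(i < M n) psi R i x * (psi R i t)^* =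
  if `[< cylinder n x t >] then (M n)%:R else 0.
Proof.
elim: n => [|n ih].
  rewrite Mprod0 big_ord_recl big_ord0 !psi0 rmorph1 mulr1 addr0.
  by case: asboolP => // -[].
pose F i := psi R i x * (psi R i t)^*.
have -> : \sum_(i < M n.+1) F i =
    (\sum_(a < m n) (rademacher R n x * (rademacher R n t)^*) ^+ a) *
    \sum_(i < M n) F i.
  rewrite sum_MprodS mulr_suml; apply: eq_bigr => a _; rewrite mulr_sumr.
  apply: eq_bigr => i _; rewrite /F !psiD // !psiM //.
  by rewrite rmorphM rmorphXn exprMn mulrACA.
rewrite ih rademacher_geom.
case: (asboolP (cylinder n x t)) => xt; last first.
  rewrite mulr0; case: asboolP => // xt'; case: xt => k kn.
  by apply: xt'; exact: ltnW.
case: eqP => e; case: asboolP => xt' //.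
- by rewrite -natrM MprodS mulnC.
- by case: xt' => k; rewrite ltnS leq_eqVlt => /predU1P[->|/xt].
- by rewrite xt' // in e.
- by rewrite mul0r.
Qed.

End System.

(** A one-sided inverse of a square matrix is two-sided. This converts kernel identities, which sum
    over characters, into orthogonality relations, which sum over points. *)
Lemma orthogonality_transpose (F : fieldType) n (c : F) (A B : 'I_n -> 'I_n -> F) :
  c != 0 -> (forall s t, \sum_i A s i * B i t = if s == t then c else 0) ->
  forall i j, \sum_s B i s * A s j = if i == j then c else 0.
Proof.
move=> c0 AB i j.
pose A' := \matrix_(s, i) A s i; pose B' := \matrix_(i, t) (B i t / c).
have /mulmx1C BA1 : A' *m B' = 1%:M.
  apply/matrixP => s t; rewrite !mxE.
  under eq_bigr do rewrite !mxE mulrA.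
  rewrite -mulr_suml AB; case: eqP => _; rewrite ?mul0r ?divff //.
have := congr1 (fun X : 'M[F]_n => X i j) BA1; rewrite !mxE.
under eq_bigr do rewrite !mxE mulrAC.
rewrite -mulr_suml => /(congr1 (fun z => z * c)); rewrite divfK // => ->.
by case: eqP; rewrite ?mul1r ?mul0r.
Qed.

(** * Finite averages, orthonormality and lower bounds for Dirichlet kernels *)

Section Averages.
Variables (R : realType) (m : nat -> nat).
Hypothesis m_ge2 : forall k : nat, (2 <= m k)%N.
Local Notation M := (Mprod m).
Local Notation G := (vilenkin m).
Local Notation coord := Defs.coord.
Local Notation psi := (@psi R m).
Implicit Types x : G.

Lemma Mprod_neq0 (F : numDomainType) n : (M n)%:R != 0 :> F.
Proof. by rewrite pnatr_eq0 -lt0n Mprod_gt0. Qed.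

(** A single sequence of points serves all ranks, so that passing from rank [n] to a finer one only
    lengthens the range of [i]. *)
Definition digit_point (i : nat) : G := fun k => (digit m i k)%:R : 'Z_(m k).
Local Notation pt := digit_point.

Lemma coord_pt i k : (coord (pt i) k : nat) = digit m i k.
Proof. by rewrite /coord /pt val_Zp_nat // modn_small // digit_lt. Qed.

Lemma cylinder_sym n x (t : G) : cylinder n x t -> cylinder n t x.
Proof. by move=> h k kn; rewrite h. Qed.

Lemma cylinder_trans n x (y t : G) : cylinder n x y -> cylinder n y t -> cylinder n x t.
Proof. by move=> h h' k kn; rewrite h' // h. Qed.

Lemma cylinder_pt_exists n x : exists2 i, (i < M n)%N & cylinder n x (pt i).
Proof.
have [//|i iM ix] := @digit_surj m m_ge2 n (fun k => coord x k).
  by move=> k; exact: coord_lt.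
by exists i => // k kn; apply/val_inj; rewrite /= coord_pt ix.
Qed.

Lemma cylinder_pt_inj n i j : (i < M n)%N -> (j < M n)%N ->
  cylinder n (pt i) (pt j) -> i = j.
Proof.
move=> iM jM ij; apply: (@digit_inj m m_ge2 n) => // k kn.
by rewrite -!coord_pt ij.
Qed.

Lemma cylinder_pt_add N a t : (t < M N)%N -> cylinder N (pt t) (pt (a * M N + t)).
Proof.
move=> tM k kN; apply/val_inj; rewrite /= !coord_pt digitD //.
have /dvdnP[e Me] := @dvdn_Mprod m _ _ kN.
rewrite [X in (X + _)%N](_ : _ = 0%N) // /digit Me MprodS.
by rewrite [(M k * _)%N]mulnC !mulnA mulnK ?Mprod_gt0 ?modnMl.
Qed.

(** The field is left open so that integrals of complex functions and real norms share one
    definition. *)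
Definition cyl_avg (F : fieldType) n (h : G -> F) : F :=
  (M n)%:R^-1 * \sum_(i < M n) h (pt i).

(** For [g] constant on cylinders of rank [n] this is the L_1 norm, by [cnorm_step] below. *)
Definition norm1 n (g : G -> R[i]) : R := cyl_avg n (fun x => cmod (g x)).

Lemma norm1_ge0 n g : 0 <= norm1 n g.
Proof. by rewrite mulr_ge0 ?sumr_ge0 // => i _; exact: cmod_ge0. Qed.

Lemma norm1_le n g h : (forall x, cmod (g x) <= cmod (h x)) -> norm1 n g <= norm1 n h.
Proof. by move=> gh; rewrite ler_wpM2l // ler_sum. Qed.

Lemma norm1_eq n g h : (forall x, cmod (g x) = cmod (h x)) -> norm1 n g = norm1 n h.
Proof. by move=> gh; congr (_ * _); apply: eq_bigr. Qed.

Lemma norm1D n g h : norm1 n (fun x => g x + h x) <= norm1 n g + norm1 n h.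
Proof.
rewrite -mulrDr ler_wpM2l // -big_split ler_sum //= => i _; exact: ler_cmodD.
Qed.

Lemma norm1BD n g h : norm1 n g - norm1 n h <= norm1 n (fun x => g x + h x).
Proof.
rewrite -mulrBr ler_wpM2l // -sumrB ler_sum //= => i _; exact: ler_cmodBD.
Qed.

Lemma norm1_sum n K (g : nat -> G -> R[i]) :
  norm1 n (fun x => \sum_(k < K) g k x) <= \sum_(k < K) norm1 n (g k).
Proof.
rewrite -mulr_sumr ler_wpM2l // exchange_big ler_sum //= => i _.
exact: ler_cmod_sum.
Qed.

Lemma norm1Z n (z : R[i]) g : norm1 n (fun x => z * g x) = cmod z * norm1 n g.
Proof.
rewrite /norm1 /cyl_avg mulrCA; congr (_ * _).
by rewrite mulr_sumr; apply: eq_bigr => i _; rewrite cmodM.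
Qed.

(** Transposes [psi_kernel], read as a product of the square matrices of character values at the
    points [pt s]; distinct points of this range lie in distinct cylinders. *)
Lemma psi_orthonormal n i j : (i < M n)%N -> (j < M n)%N ->
  cyl_avg n (fun x => psi i x * (psi j x)^*) = if i == j then 1 else 0.
Proof.
move=> iM jM.
have key := @orthogonality_transpose _ (M n) (M n)%:R
  (fun s k : 'I_(M n) => psi k (pt s)) (fun k t : 'I_(M n) => (psi k (pt t))^*)
  (Mprod_neq0 _ n).
rewrite /cyl_avg; under eq_bigr do rewrite mulrC.
have /= -> := key _ (Ordinal jM) (Ordinal iM); last first.
  move=> s t; rewrite psi_kernel //; case: asboolP; case: eqP => //.
    by move=> + /(cylinder_pt_inj (ltn_ord s) (ltn_ord t))/ord_inj.
  by move=> -> [].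
rewrite -val_eqE /= eq_sym; case: eqP; rewrite ?mulr0 // mulVf ?Mprod_neq0 //.
Qed.

(** As [a] varies, the points run through the subcylinders of rank [N.+1] inside one cylinder of
    rank [N]; the relation is the transpose of [rademacher_geom]. *)
Lemma rademacher_orth N t p q : (t < M N)%N -> (p < m N)%N -> (q < m N)%N ->
  \sum_(a < m N) (rademacher R N (pt (a * M N + t)))^* ^+ p *
     rademacher R N (pt (a * M N + t)) ^+ q = if p == q then (m N)%:R else 0.
Proof.
move=> tM pm qm; pose w a := rademacher R N (pt (a * M N + t)).
have := @orthogonality_transpose _ (m N) (m N)%:R
  (fun s k : 'I_(m N) => w s ^+ k) (fun k t : 'I_(m N) => (w t)^* ^+ k).
move=> /(_ _ _ (Ordinal pm) (Ordinal qm)) /= -> //.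
  by rewrite pnatr_eq0 -lt0n m_gt0.
move=> s s'; under eq_bigr do rewrite -exprMn.
rewrite rademacher_geom // -val_eqE /= !coord_pt !digitD // !digitM // eqxx.
by rewrite eqn_add2r.
Qed.

Definition dirichlet (j : nat) x : R[i] := \sum_(i < j) psi i x.

Lemma dirichlet_cyl N j x (t : G) : (j <= M N)%N -> cylinder N x t ->
  dirichlet j t = dirichlet j x.
Proof.
move=> jM xt; apply: eq_bigr => i _; apply: psi_cyl xt => //.
exact: leq_trans jM.
Qed.

Lemma dirichlet_pt0 j : dirichlet j (pt 0) = j%:R.
Proof.
rewrite /dirichlet (eq_bigr (fun=> 1)) ?sumr_const ?card_ord // => i _.
rewrite /psi big1 // => k _.
by rewrite rademacherE coord_pt /digit div0n mod0n mul0r cis0 expr1n.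
Qed.

Lemma dirichlet_block N q j x : (q < m N)%N -> (j <= M N)%N ->
  dirichlet (q * M N + j) x =
  \sum_(b < q) rademacher R N x ^+ b * dirichlet (M N) x +
  rademacher R N x ^+ q * dirichlet j x.
Proof.
move=> qm jM; rewrite /dirichlet (sum_blocks _ _ _ (fun i => psi i x)); congr (_ + _).
  apply: eq_bigr => b _; rewrite mulr_sumr; apply: eq_bigr => i _.
  by rewrite psiD // psiM // (ltn_trans _ qm).
rewrite mulr_sumr; apply: eq_bigr => i _.
have iM : (i < M N)%N by exact: leq_trans jM.
by rewrite psiD // psiM.
Qed.

(** On a cylinder of rank [N] the kernel is a polynomial of degree [q] in the [N]-th Rademacher
    function, with coefficients D_(M_N) below degree [q] and D_j in degree [q]. Testing against the
    [p]-th conjugate power extracts one coefficient. *)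
Lemma dirichlet_refine N p q j t : (p <= q)%N -> (q < m N)%N -> (j <= M N)%N ->
  (t < M N)%N ->
  \sum_(a < m N) (rademacher R N (pt (a * M N + t)))^* ^+ p *
     dirichlet (q * M N + j) (pt (a * M N + t)) =
  (m N)%:R * dirichlet (if p == q then j else M N) (pt t).
Proof.
move=> pq qm jM tM.
have pm := leq_ltn_trans pq qm.
under eq_bigr => a _.
  rewrite dirichlet_block // !(dirichlet_cyl _ (cylinder_pt_add a tM)) //.
  rewrite mulrDr mulr_sumr mulrA.
  under eq_bigr do rewrite mulrA.
  over.
rewrite big_split /= -mulr_suml rademacher_orth // exchange_big /=.
under eq_bigr => b _.
  rewrite -mulr_suml rademacher_orth // ?(ltn_trans _ qm) //.
  over.
rewrite -mulr_suml; case: eqP => [->|/eqP npq].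
  rewrite big1 ?mul0r ?add0r // => b _.
  by rewrite gtn_eqF.
have lpq : (p < q)%N by rewrite ltn_neqAle npq.
rewrite mul0r addr0 (bigD1 (Ordinal lpq)) //= eqxx big1 ?addr0 // => b bp.
by move: bp; rewrite -val_eqE /= eq_sym => /negbTE ->.
Qed.

Lemma dirichlet_refine_le N p q j t : (p <= q)%N -> (q < m N)%N -> (j <= M N)%N ->
  (t < M N)%N ->
  (m N)%:R * cmod (dirichlet (if p == q then j else M N) (pt t)) <=
  \sum_(a < m N) cmod (dirichlet (q * M N + j) (pt (a * M N + t))).
Proof.
move=> pq qm jM tM; rewrite -(cmod_nat R (m N)) -cmodM -(dirichlet_refine pq) //.
apply: le_trans (ler_cmod_sum _ _ _) _; rewrite ler_sum // => a _.
rewrite cmodM; elim: (p) => [|d ih]; first by rewrite expr0 cmod1 mul1r.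
by rewrite exprS cmodM cmod_conj cmod_rademacher mul1r.
Qed.

Lemma norm1S N g : norm1 N.+1 g =
  (M N)%:R^-1 * \sum_(t < M N) ((m N)%:R^-1 * \sum_(a < m N) cmod (g (pt (a * M N + t)))).
Proof.
rewrite /norm1 /cyl_avg (@sum_MprodS m _ N (fun i => cmod (g (pt i)))) exchange_big.
by rewrite -mulr_sumr mulrA -invfM -natrM -MprodS.
Qed.

Lemma norm1_dirichletS N q j : (q < m N)%N -> (j <= M N)%N ->
  norm1 N (dirichlet j) <= norm1 N.+1 (dirichlet (q * M N + j)).
Proof.
move=> qm jM; rewrite norm1S ler_wpM2l // ler_sum // => t _.
rewrite -ler_pdivrMl; last by rewrite invr_gt0 ltr0n m_gt0.
rewrite invrK; have := @dirichlet_refine_le N q q j t (leqnn _) qm jM (ltn_ord t).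
by rewrite eqxx.
Qed.

(* Testing against the constant 1 gives the alternative lower bound by
   |D_{M_N}|, which at the origin beats |D_j| by M_N - j. *)
Lemma norm1_dirichlet_gain N j : (j <= M N)%N ->
  norm1 N (dirichlet j) + (M N)%:R^-1 * ((M N)%:R - j%:R) <=
  norm1 N.+1 (dirichlet (M N + j)).
Proof.
move=> jM; rewrite norm1S -mulrDr ler_wpM2l //.
pose F t := (m N)%:R^-1 * \sum_(a < m N) cmod (dirichlet (M N + j) (pt (a * M N + t))).
have FE p t : (p <= 1)%N -> (t < M N)%N ->
    cmod (dirichlet (if p == 1%N then j else M N) (pt t)) <= F t.
  move=> p1 tM; rewrite -ler_pdivrMl; last by rewrite invr_gt0 ltr0n m_gt0.
  by rewrite invrK /F -{2}[M N]mul1n; apply: dirichlet_refine_le.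
rewrite -/(F _) (bigD1 (Ordinal (Mprod_gt0 m_ge2 N))) //=.
rewrite [X in _ <= X](bigD1 (Ordinal (Mprod_gt0 m_ge2 N))) //=.
rewrite dirichlet_pt0 cmod_nat [X in X <= _](_ : _ = (M N)%:R +
  \sum_(i < M N | i != Ordinal (Mprod_gt0 m_ge2 N)) cmod (dirichlet j (pt i))); last by ring.
apply: lerD.
  by have := FE 0%N 0%N isT (Mprod_gt0 m_ge2 N); rewrite /= dirichlet_pt0 cmod_nat.
by apply: ler_sum => t _; exact: (FE 1%N).
Qed.

(** Sorting the indices below [M N.+1] by leading digit yields [m N] copies of the previous sum,
    plus a gain of at least M_N / 2 from digit 1. As [m N <= B], this gain covers the increment
    M_(N+1) / (2B) that the induction needs. *)
Lemma norm1_dirichlet_sum (B N : nat) : (forall k, (m k <= B)%N) ->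
  (N * M N)%:R / (2 * B)%:R <= \sum_(j < M N) norm1 N (dirichlet j).
Proof.
move=> mB; elim: N => [|N ih].
  by rewrite mul0n mul0r sumr_ge0 // => j _; exact: norm1_ge0.
have B0 : (0 < B)%N by exact: leq_trans (m_gt0 m_ge2 0) (mB 0%N).
rewrite (@sum_MprodS m _ N (fun j => norm1 N.+1 (dirichlet j))).
set A := \sum_(j < M N) _ in ih.
pose gain := \sum_(j < M N) ((M N)%:R^-1 * ((M N)%:R - j%:R)) : R.
(* The exact value of [gain] is (M_N + 1) / 2. *)
have half : (M N)%:R / 2 <= gain.
  rewrite /gain -mulr_sumr ler_pdivlMl ?ltr0n ?Mprod_gt0 // sumrB sumr_const card_ord.
  suff : \sum_(i < M N) i%:R <= (M N)%:R ^+ 2 / 2 :> R by rewrite -mulr_natr; nra.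
  elim: (M N) => [|n IH]; first by rewrite big_ord0 expr0n mul0r.
  by rewrite big_ord_recr -natr1 /=; nra.
have step : (m N)%:R * A + gain <=
    \sum_(a < m N) \sum_(j < M N) norm1 N.+1 (dirichlet (a * M N + j)).
  have m1 : (1 < m N)%N by [].
  have -> : (m N)%:R * A = \sum_(a < m N) A by rewrite sumr_const card_ord mulr_natl.
  (* Leading digit 1 is split off because it carries the gain; every other digit contributes at
     least [A]. *)
  rewrite (bigD1 (Ordinal m1)) //= [X in _ <= X](bigD1 (Ordinal m1)) //=.
  rewrite addrAC lerD //.
    rewrite -big_split ler_sum //= => j _; rewrite mul1n.
    by apply: norm1_dirichlet_gain; exact: ltnW.
  rewrite ler_sum // => a _; rewrite ler_sum // => j _.
  by apply: norm1_dirichletS => //; exact: ltnW.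
apply: le_trans step; apply: le_trans (lerD (ler_wpM2l (ler0n _ (m N)) ih) half).
rewrite MprodS !natrM -natr1.
have Bp : 0 < B%:R :> R by rewrite ltr0n.
have mBR : (m N)%:R <= B%:R :> R by rewrite ler_nat.
rewrite -subr_ge0 (_ : _ - _ = (M N)%:R * (B%:R - (m N)%:R) / (2 * B%:R)).
  by rewrite !mulr_ge0 // ?subr_ge0 // invr_ge0 mulr_ge0.
by field; rewrite gt_eqF.
Qed.

End Averages.

(** * L_1 bounds for blocks and partial sums *)

Section PartialSums.
Variables (R : realType) (m : nat -> nat).
Hypothesis m_ge2 : forall k : nat, (2 <= m k)%N.
Local Notation M := (Mprod m).
Local Notation G := (vilenkin m).
Local Notation psi := (@psi R m).
Local Notation pt := (@digit_point m).
Implicit Types g : G -> R[i].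

Definition fcoef N g (k : nat) : R[i] := cyl_avg N (fun x => g x * (psi k x)^*).

(** Expanding the normalized indicator by [psi_kernel], only the trivial character survives
    averaging. *)
Lemma cyl_avg_kernel j N (t : G) : (j <= N)%N ->
  cyl_avg N (fun x : G => if `[< cylinder j x t >] then (M j)%:R else 0 : R) = 1.
Proof.
move=> jN; apply: (@complexI R).
rewrite rmorphM fmorphV rmorph_nat rmorph_sum /=.
transitivity (cyl_avg N (fun x : G => \sum_(i < M j) psi i x * (psi i t)^*)).
  congr (_ * _); apply: eq_bigr => i _; rewrite psi_kernel //.
  by case: ifP => _; rewrite ?rmorph_nat ?rmorph0.
rewrite /cyl_avg exchange_big mulr_sumr /=.
have M0 := Mprod_gt0 m_ge2.
rewrite (bigD1 (Ordinal (M0 j))) //= -[RHS]addr0; congr (_ + _).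
  rewrite (eq_bigr (fun=> 1)) => [|i _]; last by rewrite !psi0 rmorph1 mulr1.
  by rewrite sumr_const card_ord mulVf ?Mprod_neq0.
apply: big1.
move=> i i0; rewrite -mulr_suml mulrA.
have := @psi_orthonormal R m m_ge2 N i 0 (leq_trans (ltn_ord i) (leq_Mprod m_ge2 jN)) (M0 N).
rewrite /cyl_avg; under eq_bigr do rewrite psi0 rmorph1 mulr1.
by move=> ->; move: i0; rewrite -val_eqE /= => /negbTE ->; rewrite mul0r.
Qed.

(** The block is an integral operator whose kernel is a unimodular factor, coming from the character
    of index [c * M j], times the normalized cylinder indicator [kappa]. As [kappa] is nonnegative
    with mean 1, exchanging the two averages gives the bound. *)
Lemma block_contraction N j c g : (j <= N)%N ->
  norm1 N (fun x => \sum_(i < M j) fcoef N g (c * M j + i) * psi (c * M j + i) x)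
    <= norm1 N g.
Proof.
move=> jN.
pose kappa x t : R := if `[< @cylinder m j x t >] then (M j)%:R else 0.
have bound x : cmod (\sum_(i < M j) fcoef N g (c * M j + i) * psi (c * M j + i) x) <=
    cyl_avg N (fun t => cmod (g t) * kappa x t).
  have -> : \sum_(i < M j) fcoef N g (c * M j + i) * psi (c * M j + i) x =
      cyl_avg N (fun t => g t * ((psi (c * M j) t)^* * psi (c * M j) x) * (kappa x t)%:C).
    rewrite /fcoef /cyl_avg; under eq_bigr do rewrite mulrAC mulr_sumr.
    rewrite exchange_big mulr_sumr; apply: eq_bigr => t _ /=.
    have -> : (kappa x (pt t))%:C = \sum_(i < M j) psi i x * (psi i (pt t))^*.
      by rewrite psi_kernel // /kappa; case: ifP => _; rewrite ?rmorph_nat ?rmorph0.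
    rewrite !mulr_sumr; apply: eq_bigr => i _.
    by rewrite !psiD // rmorphM; ring.
  rewrite cmodM -(rmorph_nat (real_complex R)) -fmorphV cmod_real ger0_norm ?invr_ge0 //.
  rewrite ler_wpM2l //; apply: le_trans (ler_cmod_sum _ _ _) _.
  rewrite ler_sum // => t _; rewrite !cmodM cmod_conj !cmod_psi !mulr1 cmod_real.
  by rewrite ger0_norm // /kappa; case: ifP.
apply: (@le_trans _ _ (cyl_avg N (fun x => cyl_avg N (fun t => cmod (g t) * kappa x t)))).
  by rewrite ler_wpM2l // ler_sum.
rewrite /norm1 /cyl_avg -mulr_sumr exchange_big ler_wpM2l //= mulr_sumr ler_sum //= => t _.
have := cyl_avg_kernel (pt t) jN; rewrite /cyl_avg -mulr_sumr mulrCA => ->.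
by rewrite mulr1.
Qed.

(** Dividing [r] by [M j] leaves at most [B] full blocks, each a contraction, and a shorter block of
    lower rank. The offset [c] is arbitrary because that remaining block starts elsewhere. *)
Lemma partial_block_bound B N j c r g : (forall k, (m k <= B)%N) -> (j <= N)%N ->
  (r <= M j)%N ->
  norm1 N (fun x => \sum_(i < r) fcoef N g (c * M j + i) * psi (c * M j + i) x)
    <= (B * j + 1)%:R * norm1 N g.
Proof.
move=> mB; elim: j c r => [|j ih] c r jN rM.
  (* Since M_0 = 1, the sum is either empty or one full block of rank 0, whence the constant 1. *)
  rewrite muln0 mul1r; move: rM; rewrite Mprod0; case: r => [_|[|//] _].
    rewrite (@norm1_eq _ _ _ _ (fun=> 0)) => [|x]; last by rewrite big_ord0.
    rewrite (_ : norm1 N _ = 0) ?norm1_ge0 // /norm1 /cyl_avg big1 ?mulr0 // => i _.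
    exact: cmod0.
  by have := block_contraction c g jN; rewrite !Mprod0.
have M0 := Mprod_gt0 m_ge2 j.
pose q := (r %/ M j)%N; pose s := (r %% M j)%N.
have sM : (s < M j)%N by rewrite ltn_mod.
have qB : (q <= B)%N.
  apply: leq_trans (mB j); rewrite -(mulKn (m j) M0) -MprodS.
  exact: leq_div2r.
have -> : norm1 N (fun x => \sum_(i < r) fcoef N g (c * M j.+1 + i) * psi (c * M j.+1 + i) x)
  = norm1 N (fun x =>
     \sum_(b < q) \sum_(i < M j)
       fcoef N g ((c * m j + b) * M j + i) * psi ((c * m j + b) * M j + i) x +
     \sum_(i < s) fcoef N g ((c * m j + q) * M j + i) * psi ((c * m j + q) * M j + i) x).
  apply: norm1_eq => x; congr cmod; rewrite (divn_eq r (M j)) -/q -/s.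
  rewrite (sum_blocks _ _ _ (fun i => fcoef N g (c * M j.+1 + i) * psi (c * M j.+1 + i) x)).
  (* The pieces are again aligned blocks, of rank [j] and with offset [c * m j + b]. *)
  have e b i : (c * M j.+1 + (b * M j + i) = (c * m j + b) * M j + i)%N.
    by rewrite MprodS mulnDl [(M j * _)%N]mulnC mulnA addnA.
  congr (_ + _); last by apply: eq_bigr => i _; rewrite e.
  by apply: eq_bigr => b _; apply: eq_bigr => i _; rewrite e.
apply: le_trans (norm1D _ _ _) _.
have /(_ (c * m j + q)%N s) := fun c r => ih c r (ltnW jN).
move=> /(_ (ltnW sM)) h.
apply: (le_trans (lerD (y := B%:R * norm1 N g) _ h)).
  apply: le_trans (norm1_sum N q (fun b x =>
    \sum_(i < M j) fcoef N g ((c * m j + b) * M j + i) * psi ((c * m j + b) * M j + i) x)) _.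
  apply: (@le_trans _ _ (\sum_(b < q) norm1 N g)).
    by rewrite ler_sum // => b _; apply: block_contraction; exact: ltnW.
  rewrite sumr_const card_ord -[_ *+ q]mulr_natl.
  by rewrite ler_wpM2r ?norm1_ge0 ?ler_nat.
by rewrite -mulrDl -natrD mulnS addnA.
Qed.

Lemma partial_sum_bound B N r g : (forall k, (m k <= B)%N) -> (r <= M N)%N ->
  norm1 N (fun x => \sum_(i < r) fcoef N g i * psi i x) <= (B * N + 1)%:R * norm1 N g.
Proof.
move=> mB rM; have := partial_block_bound 0 g mB (leqnn N) rM.
by rewrite mul0n.
Qed.

(** D_(M_n) is the kernel of [psi_kernel] with second argument the origin [pt 0], that is, the
    normalized indicator of a cylinder. *)
Lemma norm1_dirichlet_Mprod n N : (n <= N)%N -> norm1 N (@dirichlet R m (M n)) = 1.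
Proof.
move=> nN; rewrite -(cyl_avg_kernel (pt 0) nN) /norm1 /cyl_avg; congr (_ * _).
apply: eq_bigr => i _; rewrite (_ : @dirichlet R m (M n) (pt i) =
   \sum_(k < M n) psi k (pt i) * (psi k (pt 0))^*).
  rewrite psi_kernel //; case: asboolP => _; last exact: cmod0.
  exact: cmod_nat.
apply: eq_bigr => k _.
have -> : psi k (pt 0) = 1; last by rewrite rmorph1 mulr1.
rewrite /psi big1 // => l _.
by rewrite rademacherE coord_pt // /digit div0n mod0n mul0r cis0 expr1n.
Qed.

End PartialSums.

(** * Functions constant on cylinders and their Haar integrals *)

Section StepFunctions.
Variables (R : realType) (m : nat -> nat).
Hypothesis m_ge2 : forall k : nat, (2 <= m k)%N.
Local Notation M := (Mprod m).
Local Notation G := (vilenkin m).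
Local Notation coord := Defs.coord.
Local Notation psi := (@psi R m).
Local Notation pt := (@digit_point m).
Implicit Types x y : G.

Definition step_fun T n (h : G -> T) := forall x y, cylinder n x y -> h y = h x.

Lemma open_cylinder n x : open (cylinder n x).
Proof.
elim: n => [|n ih].
  rewrite (_ : cylinder 0 x = setT); first exact: openT.
  by apply/seteqP; split.
rewrite (_ : cylinder n.+1 x = cylinder n x `&`
    (proj n : G -> discrete_topology 'Z_(m n)) @^-1` [set x n]); last first.
  apply/seteqP; split=> y /= => [h|[h e] k].
    by split; [move=> k kn; apply: h; exact: ltnW | exact: h].
  by rewrite ltnS leq_eqVlt => /predU1P[->|/h].
apply: openI => //; apply: open_comp => [y _|]; first exact: proj_continuous.
exact: discrete_open.
Qed.

Lemma measurable_cylinder n x : measurable (cylinder n x : set G).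
Proof. by apply: sub_sigma_algebra; exact: open_cylinder. Qed.

Lemma step_funE n (h : G -> R) x : step_fun n h ->
  h x = \sum_(i < M n) h (pt i) * \1_(cylinder n (pt i)) x.
Proof.
move=> hn; have [i iM ix] := cylinder_pt_exists m_ge2 n x.
rewrite (bigD1 (Ordinal iM)) //= indicE mem_set ?mulr1; last exact: cylinder_sym.
rewrite big1 ?addr0 ?(hn _ _ ix) // => j ji.
rewrite indicE memNset ?mulr0 // => jx; move: ji.
have /(cylinder_pt_inj m_ge2 (ltn_ord j) iM) e := cylinder_trans jx ix.
by rewrite -val_eqE /= e eqxx.
Qed.

(** Exhibits every preimage as a finite union of cylinders, hence measurable for the sigma-algebra
    that they generate, whatever [Y] is. *)
Lemma step_preimage T n (h : G -> T) (Y : set T) : step_fun n h ->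
  h @^-1` Y = \big[setU/set0]_(i < M n | `[< Y (h (pt i)) >]) cylinder n (pt i).
Proof.
move=> hn; apply/seteqP; split=> x /=.
  have [i iM ix] := cylinder_pt_exists m_ge2 n x => Yx.
  rewrite -bigcup_seq_cond; exists (Ordinal iM); last exact: cylinder_sym.
  by rewrite /= mem_index_enum; apply/asboolP; rewrite (hn _ _ ix).
by rewrite -bigcup_seq_cond => -[i /= /andP[_ /asboolP Yi]] /hn ->.
Qed.

Lemma Fmeasurable_step n (g : G -> R[i]) : step_fun n g -> Fmeasurable n g.
Proof.
move=> gn; have key (h : G -> R) : step_fun n h ->
    @measurable_fun _ _ (g_sigma_algebraType (range (@cylinder m n))) _ setT h.
  move=> hn _ Y mY; rewrite setTI (step_preimage _ hn).
  apply: bigsetU_measurable => i _; apply: sub_sigma_algebra.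
  by exists (pt i).
by split; apply: key => x y /gn ->.
Qed.

Variable mu : probability G R.
Hypothesis mu_haar : haar mu.

(** Translation by x - y carries one cylinder onto the other. *)
Lemma cylinder_haar_eq n x y : mu (cylinder n x) = mu (cylinder n y).
Proof.
pose z : G := fun k => coord x k - coord y k.
rewrite -(mu_haar z (measurable_cylinder n y)); congr (mu _).
apply/seteqP; split=> [w xw|_ [w yw <-] k kn].
  exists (fun k => coord w k - coord z k : 'Z_(m k)).
    by move=> k kn; rewrite {1}/coord xw // /z /coord opprB addrCA subrr addr0.
  by apply: functional_extensionality_dep => k; rewrite /vadd /coord addrC subrK.
by rewrite /coord /vadd yw // /z /coord subrK.
Qed.

Lemma integrable_indicZ n i (c : R) :
  mu.-integrable setT (fun x => (c * \1_(cylinder n (pt i)) x)%:E).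
Proof.
under eq_fun do rewrite EFinM.
apply: integrableZl => //; apply: integrable_indic => //.
  exact: measurable_cylinder.
Qed.

Lemma integrable_step n (h : G -> R) : step_fun n h -> mu.-integrable setT (EFin \o h).
Proof.
move=> hn; rewrite (_ : EFin \o h = fun x =>
  (\sum_(i < M n) (h (pt i) * \1_(cylinder n (pt i)) x)%:E)%E); last first.
  by apply/funext => x; rewrite sumEFin -step_funE.
by apply: integrable_sum => // i _; exact: integrable_indicZ.
Qed.

Lemma integral_step_measure n (h : G -> R) : step_fun n h ->
  (\int[mu]_x (h x)%:E = \sum_(i < M n) (h (pt i))%:E * mu (cylinder n (pt i)))%E.
Proof.
move=> hn; under eq_integral do rewrite (step_funE _ hn) -sumEFin.
rewrite integral_sum // => [|i]; last exact: integrable_indicZ.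
apply: eq_bigr => i _; under eq_integral do rewrite EFinM.
have mc := measurable_cylinder n (pt i).
rewrite integralZl // ?integral_indic ?setIT //.
by apply: integrable_indic.
Qed.

(** Integrating the constant 1 shows that [M n] cylinders of equal measure have total mass 1. *)
Lemma cylinder_measure n x : mu (cylinder n x) = ((M n)%:R^-1)%:E.
Proof.
have : (\int[mu]_y (1%:E : \bar R) = 1)%E.
  by rewrite integral_cst // mul1e; exact: probability_setT.
rewrite (@integral_step_measure n (fun=> 1)) //.
under eq_bigr do rewrite mul1e (cylinder_haar_eq _ _ x).
have fin : mu (cylinder n x) \is a fin_num.
  by rewrite fin_num_measure //; exact: measurable_cylinder.
rewrite -(fineK fin) sumEFin sumr_const card_ord -[_ *+ M n]mulr_natl => -[e].
by rewrite -[in LHS](mulKf (Mprod_neq0 m_ge2 R n) (fine _)) e mulr1.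
Qed.

Lemma integral_step n (h : G -> R) : step_fun n h ->
  (\int[mu]_x (h x)%:E = (cyl_avg n h)%:E)%E.
Proof.
move=> hn; rewrite (integral_step_measure hn) /cyl_avg mulr_sumr -sumEFin.
by apply: eq_bigr => i _; rewrite cylinder_measure -EFinM mulrC.
Qed.

Lemma cintegrable_step n (g : G -> R[i]) : step_fun n g -> cintegrable mu g.
Proof.
move=> gn; split.
  by apply: (@integrable_step n (fun x => complex.Re (g x))) => x y /gn ->.
by apply: (@integrable_step n (fun x => complex.Im (g x))) => x y /gn ->.
Qed.

Lemma cintegral_step n (g : G -> R[i]) : step_fun n g ->
  cintegral mu g = cyl_avg n g.
Proof.
move=> gn; rewrite /cintegral /Rintegral.
rewrite (@integral_step n (fun x => complex.Re (g x))) => [|x y /gn -> //].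
rewrite (@integral_step n (fun x => complex.Im (g x))) => [|x y /gn -> //] /=.
rewrite /cyl_avg -(rmorph_nat (real_complex R)) -fmorphV.
(* The factor 1 / M_n is generalized to [c], so that the induction is on the number of summands
   alone. *)
elim: (M n) (_^-1) => [|k ih] c; first by rewrite !big_ord0 !mulr0.
rewrite !big_ord_recr /= !mulrDr -ih.
case: (g (pt k)) => a b; apply/eqP; rewrite eq_complex /=.
by apply/andP; split; apply/eqP; ring.
Qed.

Lemma cnorm_step n (g : G -> R[i]) : step_fun n g -> cnorm mu 1 g = (norm1 n g)%:E.
Proof.
move=> gn; rewrite /cnorm Lnorm1 -integral_step => [|x y /gn -> //].
by apply: eq_integral => x _; rewrite abse_EFin ger0_norm // cmod_ge0.
Qed.

Lemma step_fun_psi n k : (k < M n)%N -> step_fun n (psi k).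
Proof. by move=> kn x y; exact: psi_cyl. Qed.

Lemma step_fun_sum n K (c : nat -> R[i]) : (K <= M n)%N ->
  step_fun n (fun x => \sum_(k < K) c k * psi k x).
Proof.
move=> KM x y xy; apply: eq_bigr => k _; congr (_ * _).
by apply: step_fun_psi xy; exact: leq_trans KM.
Qed.

Lemma step_fun_le T n N (h : G -> T) : (n <= N)%N -> step_fun n h -> step_fun N h.
Proof. by move=> nN hn x y xy; apply: hn => k kn; apply: xy; exact: leq_trans nN. Qed.

(** Both sides compute the same integral norm, so the rank may be raised freely. *)
Lemma norm1_step_le n N (g : G -> R[i]) : (n <= N)%N -> step_fun n g ->
  norm1 N g = norm1 n g.
Proof.
move=> nN gn; apply/EFin_inj; rewrite -!cnorm_step //.
exact: step_fun_le gn.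
Qed.

Lemma fourier_step n (g : G -> R[i]) k : step_fun n g -> (k < M n)%N ->
  fourier mu g k = fcoef n g k.
Proof.
move=> gn kM; rewrite /fourier (@cintegral_step n) // => x y xy.
by rewrite (gn _ _ xy) (step_fun_psi kM xy).
Qed.

Lemma fourier_sum n (c : nat -> R[i]) j : (j < M n)%N ->
  fourier mu (fun x => \sum_(k < M n) c k * psi k x) j = c j.
Proof.
move=> jM; rewrite (fourier_step (step_fun_sum _ (leqnn _)) jM).
rewrite /fcoef /cyl_avg; under eq_bigr do rewrite mulr_suml.
rewrite exchange_big mulr_sumr (bigD1 (Ordinal jM)) //= -[RHS]addr0.
have e k : (k < M n)%N -> (M n)%:R^-1 * (\sum_(i < M n) c k * psi k (pt i) * (psi j (pt i))^*) =
    c k * (if k == j then 1 else 0).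
  move=> kM; rewrite -(psi_orthonormal R m_ge2 kM jM) /cyl_avg mulrCA.
  by congr (_ * _); rewrite mulr_sumr; apply: eq_bigr => i _; rewrite mulrA.
congr (_ + _); first by rewrite e // eqxx mulr1.
rewrite big1 // => k kj; rewrite e //.
by move: kj; rewrite -val_eqE /= => /negbTE ->; rewrite mulr0.
Qed.

End StepFunctions.

(** * Martingales as character sums, and the upper bound for strong means *)

Section Martingales.
Variables (R : realType) (m : nat -> nat).
Hypothesis m_ge2 : forall k : nat, (2 <= m k)%N.
Local Notation M := (Mprod m).
Local Notation G := (vilenkin m).
Local Notation psi := (@psi R m).
Local Notation pt := (@digit_point m).
Local Notation dirichlet := (@dirichlet R m).
Variable mu : probability G R.
Hypothesis mu_haar : haar mu.
Implicit Types f : nat -> G -> R[i].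

Lemma mfourier_stationary f N k (z : R[i]) :
  (forall l, (N <= l)%N -> fourier mu (f l) k = z) -> mfourier mu f k = z.
Proof.
move=> fz; rewrite /mfourier; apply: (@lim_near_cst (R[i]^o)) => //.
by exists N => // l /= Nl; exact: fz.
Qed.

(** [f N] is a partial sum of each later [f l], hence shares its coefficients below [M N]; the limit
    is reached at stage [N]. *)
Lemma martingale_mfourier f N k : martingale mu f -> (k < M N)%N ->
  mfourier mu f k = fourier mu (f N) k.
Proof.
move=> [_ _ fM] kM; apply: (@mfourier_stationary _ N) => l Nl.
by rewrite -(funext (fM _ _ Nl)) /psum fourier_sum.
Qed.

(** With equal indices, the martingale identity says that [f n] is its own partial sum of order
    [M n]. *)
Lemma martingale_step f n : martingale mu f -> step_fun n (f n).
Proof.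
by move=> [_ _ fM]; rewrite -(funext (fM _ _ (leqnn n))); exact: step_fun_sum.
Qed.

Lemma mpsum_fcoef f N K : martingale mu f -> (K <= M N)%N ->
  mpsum mu f K = fun x => \sum_(i < K) fcoef N (f N) i * psi i x.
Proof.
move=> fM KM; apply/funext => x; apply: eq_bigr => i _.
have iM : (i < M N)%N by exact: leq_trans KM.
rewrite (martingale_mfourier fM iM) (fourier_step m_ge2 mu_haar (@martingale_step f N fM)) //.
Qed.

Lemma measurable_step n (h : G -> R) : step_fun n h ->
  measurable_fun [set: G] (EFin \o h).
Proof. by move=> hn; have /integrableP[] := integrable_step m_ge2 mu hn. Qed.

Lemma step_fun_cmod n (g : G -> R[i]) : step_fun n g -> step_fun n (fun x => cmod (g x)).
Proof. by move=> gn x y /gn ->. Qed.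

Lemma measurable_maximal f : martingale mu f -> measurable_fun [set: G] (maximal f).
Proof.
move=> fM; rewrite (_ : maximal f = fun x => esups (fun n => (cmod (f n x))%:E) 0%N); last first.
  apply/funext => x; rewrite /maximal /esups /sdrop; congr ereal_sup.
  by apply/seteqP; split=> _ [n _ <-]; exists n.
apply: measurable_fun_esups => n; apply: (@measurable_step n).
exact/step_fun_cmod/martingale_step.
Qed.

Lemma maximal_ge f x n : ((cmod (f n x))%:E <= maximal f x)%E.
Proof. by apply: ereal_sup_ubound; exists n. Qed.

Lemma maximal_ge0 f x : (0 <= maximal f x)%E.
Proof. by apply: le_trans (maximal_ge f x 0); rewrite lee_fin cmod_ge0. Qed.

Lemma Hnorm1E f : Hnorm mu 1 f = (\int[mu]_x maximal f x)%E.
Proof.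
by rewrite /Hnorm Lnorm1; apply: eq_integral => x _; rewrite gee0_abs ?maximal_ge0.
Qed.

Lemma norm1_le_Hnorm f N : martingale mu f -> ((norm1 N (f N))%:E <= Hnorm mu 1 f)%E.
Proof.
move=> fM; have fN := @martingale_step f N fM.
rewrite Hnorm1E -(integral_step m_ge2 mu_haar (step_fun_cmod fN)).
apply: ge0_le_integral => //.
- by move=> x _; rewrite lee_fin cmod_ge0.
- exact: measurable_step (step_fun_cmod fN).
- exact: measurable_maximal.
- by move=> x _; exact: maximal_ge.
Qed.

Lemma cnorm_mpsum_le f B N K : martingale mu f -> (forall k, (m k <= B)%N) ->
  (K <= M N)%N ->
  (cnorm mu 1 (mpsum mu f K) <= ((B * N + 1)%:R * norm1 N (f N))%:E)%E.
Proof.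
move=> fM mB KM; rewrite (mpsum_fcoef fM KM).
rewrite (cnorm_step m_ge2 mu_haar (step_fun_sum m_ge2 (fcoef N (f N)) KM)) lee_fin.
exact: partial_sum_bound.
Qed.

(** With l = [trunc_log 2 n], the bound l >= 1 absorbs the additive constants, B (l + 1) + 1 <= 2 (B
    + 1) l, and 2^l <= n gives l <= ln n / ln 2. *)
Lemma log_factor_le (B n : nat) : (2 <= n)%N ->
  (B * (trunc_log 2 n).+1 + 1)%:R <= (B.+1 * 2)%:R / ln 2 * ln n%:R :> R.
Proof.
move=> n2; set l := trunc_log 2 n.
have l1 : (1 <= l)%N by rewrite trunc_log_max.
have ln2 : 0 < ln 2 :> R by rewrite ln_gt0 // ltr1n.
have ll : l%:R * ln 2 <= ln n%:R :> R.
  rewrite mulr_natl -lnXn // ler_ln ?posrE ?exprn_gt0 ?ltr0n //; last by lia.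
  by rewrite -natrX ler_nat; apply: trunc_logP; lia.
apply: (@le_trans _ _ (B.+1 * 2 * l)%:R).
  by rewrite ler_nat; nia.
rewrite natrM mulrAC -mulrA ler_wpM2l ?ler0n //.
by rewrite ler_pdivlMr.
Qed.

(** One rank [N] with n < 2^N <= M_N serves all k <= n, so every summand obeys the same bound of
    order ln n times the norm of [f N]. *)
Lemma strong_mean_upper f B n : martingale mu f -> (forall k, (m k <= B)%N) ->
  (2 <= n)%N ->
  ((n%:R * ln n%:R)^-1%:E * \sum_(1 <= k < n.+1) cnorm mu 1 (mpsum mu f k) <=
   ((B.+1 * 2)%:R / ln 2)%:E * Hnorm mu 1 f)%E.
Proof.
move=> fM mB n2; set N := (trunc_log 2 n).+1; set C := _ / _.
have nM : (n < M N)%N.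
  by apply: leq_trans (leq_expn2_Mprod m_ge2 N); exact: trunc_log_ltn.
have ln2 : 0 < ln 2 :> R by rewrite ln_gt0 // ltr1n.
have lnn : 0 < ln n%:R :> R by rewrite ln_gt0 // ltr1n.
have n0 : 0 < n%:R :> R by rewrite ltr0n; lia.
have C0 : 0 <= C by rewrite divr_ge0 // ltW.
set a := norm1 N (f N); have a0 : 0 <= a by exact: norm1_ge0.
apply: (@le_trans _ _ (C * a)%:E); last first.
  by rewrite EFinM lee_wpmul2l // ?lee_fin //; exact: norm1_le_Hnorm.
apply: (@le_trans _ _ ((n%:R * ln n%:R)^-1%:E * (n%:R * (C * ln n%:R * a))%:E)%E).
  apply: lee_wpmul2l; first by rewrite lee_fin invr_ge0 mulr_ge0 // ltW.
  apply: (@le_trans _ _ (\sum_(1 <= k < n.+1) (C * ln n%:R * a)%:E)%E).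
    rewrite big_nat_cond [leRHS]big_nat_cond; apply: lee_sum => k.
    rewrite andbT => /andP[_ kn].
    apply: (le_trans (cnorm_mpsum_le (N := N) fM mB _)); first by lia.
    by rewrite lee_fin ler_wpM2r //; exact: log_factor_le.
  by rewrite sumEFin sumr_const_nat subn1 lee_fin mulr_natl.
rewrite -EFinM lee_fin le_eqVlt; apply/orP; left; apply/eqP.
by field; rewrite !gt_eqF.
Qed.

End Martingales.

(** * The lacunary martingale and its lower bounds *)

Section Lacunary.
Variables (R : realType) (m : nat -> nat).
Hypothesis m_ge2 : forall k : nat, (2 <= m k)%N.
Local Notation M := (Mprod m).
Local Notation G := (vilenkin m).
Local Notation psi := (@psi R m).
Local Notation dirichlet := (@dirichlet R m).
Variable mu : probability G R.
Hypothesis mu_haar : haar mu.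
Variable lam : nat -> R.
Hypothesis lam_ge0 : forall N, 0 <= lam N.
Hypothesis lam_sum : forall n, \sum_(N < n) lam N <= 2.

(** Coefficients of the sum of the blocks lam_N psi_(M_N) D_(M_N), the [N]-th of which has spectrum
    [M_N, 2 M_N). The range N < k suffices because M_N <= k forces N < k. *)
Definition lacunary_coef (k : nat) : R :=
  \sum_(N < k) if (M N <= k < 2 * M N)%N then lam N else 0.

Definition lacunary (n : nat) (x : G) : R[i] :=
  \sum_(k < M n) (lacunary_coef k)%:C * psi k x.

(** The spectra of distinct blocks are disjoint, because 2 M_i <= M_(i+1). *)
Lemma lacunary_coefE N k : (M N <= k < M N.+1)%N ->
  lacunary_coef k = if (k < 2 * M N)%N then lam N else 0.
Proof.
move=> /andP[Nk kN].
have lNk : (N < k)%N by exact: leq_trans (ltn_Mprod m_ge2 N) Nk.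
rewrite /lacunary_coef (bigD1 (Ordinal lNk)) //= Nk big1 ?addr0 // => i iN.
case: ifP => // /andP[ik ki].
have [iltN|Nlti|eN] := ltngtP i N.
- have : (2 * M i <= M N)%N.
    by apply: leq_trans (double_Mprod_leq m_ge2 i) (leq_Mprod m_ge2 iltN).
  lia.
- by have := leq_Mprod m_ge2 Nlti; lia.
- by move: iN; rewrite -val_eqE /= eN eqxx.
Qed.

Lemma lacunary_partial N j x : (j <= M N)%N ->
  \sum_(k < M N + j) (lacunary_coef k)%:C * psi k x =
  lacunary N x + (lam N)%:C * (psi (M N) x * dirichlet j x).
Proof.
move=> jM; rewrite (sum_ordD _ _ (fun k => (lacunary_coef k)%:C * psi k x)).
congr (_ + _); rewrite !mulr_sumr; apply: eq_bigr => i _.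
have iM : (i < M N)%N by exact: leq_trans jM.
have MM := double_Mprod_leq m_ge2 N.
rewrite (@lacunary_coefE N) ?ifT; [|lia|lia].
by have := psiD R m_ge2 1 x iM; rewrite mul1n => ->.
Qed.

Lemma lacunaryS N x :
  lacunary N.+1 x = lacunary N x + (lam N)%:C * (psi (M N) x * dirichlet (M N) x).
Proof.
rewrite -lacunary_partial // /lacunary.
have MM := double_Mprod_leq m_ge2 N.
(* The remaining [r] indices, from 2 M_N to M_(N+1), carry zero coefficients. *)
have [r e] : exists r, M N.+1 = (M N + M N + r)%N.
  by exists (M N.+1 - (M N + M N))%N; lia.
rewrite e (sum_ordD _ _ (fun k => (lacunary_coef k)%:C * psi k x)).
rewrite [X in _ + X]big1 ?addr0 // => i _.
rewrite (@lacunary_coefE N) ?ifF ?mul0r //; have := ltn_ord i; lia.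
Qed.

Lemma lacunaryE n x :
  lacunary n x = \sum_(N < n) (lam N)%:C * (psi (M N) x * dirichlet (M N) x).
Proof.
elim: n => [|n ih]; last by rewrite lacunaryS ih big_ord_recr.
rewrite big_ord0 /lacunary Mprod0 big_ord_recl big_ord0 /lacunary_coef big_ord0.
by rewrite mul0r addr0.
Qed.

Lemma step_lacunary n : step_fun n (lacunary n).
Proof. exact: (step_fun_sum m_ge2 (fun k => (lacunary_coef k)%:C)). Qed.

Lemma lacunary_martingale : martingale mu lacunary.
Proof.
split=> [n|n|n l nl x].
- exact: (cintegrable_step m_ge2 mu (@step_lacunary n)).
- exact: (Fmeasurable_step m_ge2 (@step_lacunary n)).
- apply: eq_bigr => k _; congr (_ * _).
  rewrite (fourier_sum m_ge2 mu_haar (fun k => (lacunary_coef k)%:C)) //.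
  exact: leq_trans (leq_Mprod m_ge2 nl).
Qed.

Lemma lacunary_mfourier k : mfourier mu lacunary k = (lacunary_coef k)%:C.
Proof.
apply: (@mfourier_stationary _ _ mu lacunary k) => l kl.
rewrite (fourier_sum m_ge2 mu_haar (fun k => (lacunary_coef k)%:C)) //.
exact: leq_ltn_trans kl (ltn_Mprod m_ge2 l).
Qed.

Lemma cmod_block N x :
  cmod ((lam N)%:C * (psi (M N) x * dirichlet (M N) x)) = lam N * cmod (dirichlet (M N) x).
Proof. by rewrite !cmodM cmod_real cmod_psi mul1r ger0_norm. Qed.

Lemma step_dirichlet N j : (j <= M N)%N -> step_fun N (dirichlet j).
Proof. by move=> jM x y; exact: dirichlet_cyl. Qed.

Lemma lacunary_hardy : hardy mu 1 lacunary.
Proof.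
split; first exact: lacunary_martingale.
pose u N x : \bar R := (lam N * cmod (dirichlet (M N) x))%:E.
have u0 N x : (0 <= u N x)%E by rewrite lee_fin mulr_ge0 // cmod_ge0.
have ustep N : step_fun N (fun x => lam N * cmod (dirichlet (M N) x)).
  by move=> x y /(step_dirichlet (leqnn _)) ->.
have mu_u N : measurable_fun [set: G] (u N) by exact: (measurable_step m_ge2 mu (ustep N)).
have max_le x : (maximal lacunary x <= \sum_(0 <= N <oo) u N x)%E.
  apply: ub_ereal_sup => _ [n _ <-].
  apply: (@le_trans _ _ (\sum_(0 <= N < n) u N x)%E); last exact: nneseries_lim_ge.
  rewrite sumEFin lee_fin lacunaryE big_mkord; apply: le_trans (ler_cmod_sum _ _ _) _.
  by apply: ler_sum => N _; rewrite cmod_block.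
have int_u N : (\int[mu]_x u N x = (lam N)%:E)%E.
  rewrite (integral_step m_ge2 mu_haar (ustep N)); congr _%:E.
  rewrite /cyl_avg -mulr_sumr mulrCA -[RHS]mulr1; congr (_ * _).
  exact: (norm1_dirichlet_Mprod R m_ge2 (leqnn N)).
rewrite Hnorm1E; apply: (@le_lt_trans _ _ 2%:E); last exact: ltry.
apply: (@le_trans _ _ (\int[mu]_x (\sum_(0 <= N <oo) u N x)))%E.
  apply: ge0_le_integral => //.
  - by move=> x _; exact: maximal_ge0.
  - exact: (measurable_maximal m_ge2 lacunary_martingale).
  - by apply: ge0_emeasurable_sum.
(* Monotone convergence reduces the claim to the partial sums of [lam], all at most 2. *)
rewrite integral_nneseries //; under eq_eseriesr do rewrite int_u.
apply: lime_le; first by apply: is_cvg_nneseries => N _ _; rewrite lee_fin.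
by near=> n; rewrite sumEFin lee_fin big_mkord.
Unshelve. all: by end_near.
Qed.

(** The partial sum is [lacunary N] plus a piece of the next block. That piece has norm lam_N times
    that of D_j, its character being unimodular, and the subtracted 2 bounds the norm of
    [lacunary N]. *)
Lemma cnorm_lacunary_ge N j : (j < M N)%N ->
  ((lam N * norm1 N (dirichlet j) - 2)%:E <= cnorm mu 1 (mpsum mu lacunary (M N + j)))%E.
Proof.
move=> jM.
have -> : mpsum mu lacunary (M N + j) =
    fun x => \sum_(k < M N + j) (lacunary_coef k)%:C * psi k x.
  by apply/funext => x; apply: eq_bigr => k _; rewrite lacunary_mfourier.
have MM := double_Mprod_leq m_ge2 N.
rewrite (cnorm_step (n := N.+1) m_ge2 mu_haar); last first.
  by apply: (step_fun_sum m_ge2 (fun k => (lacunary_coef k)%:C)); lia.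
rewrite lee_fin.
rewrite [leRHS](@norm1_eq _ _ _ _ (fun x => (lam N)%:C * (psi (M N) x * dirichlet j x) +
  lacunary N x)); last first.
  by move=> x /=; rewrite lacunary_partial 1?addrC // ltnW.
apply: le_trans (norm1BD _ _ _); apply: lerB.
  rewrite norm1Z cmod_real ger0_norm // ler_wpM2l //.
  rewrite -(norm1_step_le m_ge2 mu_haar (leqnSn N) (step_dirichlet (ltnW jM))).
  by apply: norm1_le => x; rewrite cmodM cmod_psi mul1r.
apply: le_trans (lam_sum N).
rewrite [leLHS](@norm1_eq _ _ _ _ (fun x =>
  \sum_(n < N) (lam n)%:C * (psi (M n) x * dirichlet (M n) x))); last first.
  by move=> x; rewrite lacunaryE.
apply: le_trans (norm1_sum _ _ (fun n x => (lam n)%:C * (psi (M n) x * dirichlet (M n) x))) _.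
apply: ler_sum => n _; rewrite norm1Z cmod_real ger0_norm //.
rewrite -[leRHS]mulr1 ler_wpM2l //.
rewrite -(norm1_dirichlet_Mprod R m_ge2 (_ : n <= N.+1)%N); last by have := ltn_ord n; lia.
by apply: norm1_le => x; rewrite cmodM cmod_psi mul1r.
Qed.

Lemma cnorm_ge0 (g : G -> R[i]) : (0 <= cnorm mu 1 g)%E.
Proof. exact: Lnorm_ge0. Qed.

(** Only the indices in [M_N, 2 M_N) are kept; they contribute at least lam_N N M_N / (2B) - 2 M_N.
    After division by 2 M_N phi, the loss 1 / phi is at most 1. *)
Lemma strong_mean_lower (B N : nat) (phi : R) : (forall k, (m k <= B)%N) -> 1 <= phi ->
  ((lam N * N%:R / phi / (4 * B)%:R - 1)%:E <=
   (((2 * M N)%:R * phi)^-1)%:E *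
     \sum_(1 <= k < (2 * M N).+1) cnorm mu 1 (mpsum mu lacunary k))%E.
Proof.
move=> mB phi1.
have M0 := Mprod_gt0 m_ge2 N.
have B0 : (0 < B)%N by exact: leq_trans (m_gt0 m_ge2 0) (mB 0%N).
have p0 : 0 < phi by exact: lt_le_trans phi1.
have MR : 0 < (M N)%:R :> R by rewrite ltr0n.
have BR : 0 < B%:R :> R by rewrite ltr0n.
set X := (_ - 1).
have XE : X%:E = ((((2 * M N)%:R * phi)^-1)%:E * ((2 * M N)%:R * phi * X)%:E)%E.
  by rewrite -EFinM; congr _%:E; rewrite mulKf // mulf_neq0 ?gt_eqF // natrM mulr_gt0.
rewrite XE; apply: lee_wpmul2l.
  by rewrite lee_fin invr_ge0 mulr_ge0 // ltW.
apply: (@le_trans _ _ (\sum_(j < M N) cnorm mu 1 (mpsum mu lacunary (M N + j)))%E); last first.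
  rewrite (big_cat_nat (n := M N)) //=; last by lia.
  rewrite [X in (_ + X)%E](big_cat_nat (n := (M N + M N)%N)) /=; [|lia|lia].
  apply: (le_trans _ (leeDr _ _)); last by apply: sume_ge0 => k _; exact: cnorm_ge0.
  apply: (le_trans _ (leeDl _ _)); last by apply: sume_ge0 => k _; exact: cnorm_ge0.
  rewrite -[X in (_ <= \sum_(X <= _ < _) _)%E]add0n big_addn addnK big_mkord.
  by apply: lee_sum => j _; rewrite addnC.
apply: (@le_trans _ _ (\sum_(j < M N) (lam N * norm1 N (dirichlet j) - 2)%:E)%E); last first.
  by apply: lee_sum => j _; exact: cnorm_lacunary_ge.
rewrite sumEFin lee_fin sumrB sumr_const card_ord -mulr_sumr -[2 *+ _]mulr_natr.
have := ler_wpM2l (lam_ge0 N) (norm1_dirichlet_sum R m_ge2 N mB).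
set S := \sum_(j < M N) _; rewrite !natrM => h.
have -> : 2 * (M N)%:R * phi * X = lam N * (N%:R * (M N)%:R / (2 * B%:R)) - 2 * (M N)%:R * phi.
  by rewrite /X natrM; field; rewrite !gt_eqF.
apply: lerB => //.
by rewrite ler_peMr // mulr_ge0 // ltW.
Qed.

End Lacunary.

(** * Choosing the levels and their weights *)

Section Choice.
Variables (R : realType) (m : nat -> nat).
Hypothesis m_ge2 : forall k : nat, (2 <= m k)%N.
Local Notation M := (Mprod m).

Lemma limn_esup_pinfty (u : nat -> R) : limn_esup (fun n => (u n)%:E) = +oo%E ->
  forall A n0, exists2 n, (n0 <= n)%N & A < u n.
Proof.
move=> uy A n0; apply: contrapT => /forall2NP h.
suff : (limn_esup (fun n => (u n)%:E) <= A%:E)%E by rewrite uy leye_eq.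
rewrite /limn_esup limf_esupE.
apply: (@le_trans _ _ (ereal_sup [set (u n)%:E | n in [set n | (n0 <= n)%N]])).
  by apply: ereal_inf_lbound; exists [set n | (n0 <= n)%N] => //; exists n0.
apply: ub_ereal_sup => _ [n /= n0n <-]; rewrite lee_fin leNgt.
by case: (h n) => // /negP.
Qed.

Lemma leq_Mprod_expn B k : (forall k, (m k <= B)%N) -> (M k <= B ^ k)%N.
Proof.
by move=> mB; elim: k => [|k ih]; rewrite ?Mprod0 // MprodS expnSr leq_mul.
Qed.

(** Supplies a level where the weight 2^-k still leaves a quantity of size [k]. Boundedness of [m]
    makes ln n comparable to the level of n, and monotonicity moves phi from n down to 2 M_N. *)
Lemma growth_levels (B : nat) (phi : nat -> R) (k : nat) :
  (forall k, (m k <= B)%N) ->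
  (forall n : nat, (1 <= n)%N -> 1 <= phi n) ->
  (forall n k : nat, (1 <= n)%N -> (n <= k)%N -> phi n <= phi k) ->
  limn_esup (fun n : nat => (ln n%:R / phi n)%:E) = +oo%E ->
  exists2 N, (k <= N)%N & k%:R <= 2 ^- k * N%:R / phi (2 * M N)%N.
Proof.
move=> mB phi1 phi_mono /limn_esup_pinfty phi_lim.
have B2 : (2 <= B)%N by exact: leq_trans (m_ge2 0) (mB 0%N).
have lnB : 0 < ln B%:R :> R by rewrite ln_gt0 // ltr1n.
(* The factor 3 ln B pays for ln n <= 3 N ln B below; starting at [M k.+2] ensures N > k, hence N >=
   1. *)
have [n nlarge] := phi_lim (3 * ln B%:R * (k%:R * 2 ^+ k)) (M k.+2).
have n0 : (0 < n)%N by exact: leq_trans (Mprod_gt0 m_ge2 _) nlarge.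
have [N' /andP[lo hi]] := Mprod_bracket m_ge2 n0.
have kN' : (k.+2 <= N')%N.
  by rewrite leqNgt; apply/negP => /(leq_Mprod m_ge2); lia.
(* One level below the bracket, so that 2 M_N <= M_(N+1) <= n. *)
case: N' kN' lo hi => // N kN lo hi lt; exists N; first by lia.
have MN := double_Mprod_leq m_ge2 N.
have M0 := Mprod_gt0 m_ge2 N.
have p0 : 0 < phi (2 * M N)%N by apply: lt_le_trans (phi1 _ _) => //; lia.
have pn : phi (2 * M N)%N <= phi n by apply: phi_mono; lia.
have pn0 := lt_le_trans p0 pn.
have lnn : ln n%:R <= (3 * N)%:R * ln B%:R :> R.
  apply: (@le_trans _ _ (N.+2%:R * ln B%:R)); last first.
    by rewrite ler_wpM2r ?ler_nat ?ltW //; lia.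
  rewrite mulr_natl -lnXn ?ltr0n //; last by lia.
  rewrite ler_ln ?posrE ?exprn_gt0 ?ltr0n //; last by lia.
  rewrite -natrX ler_nat; apply: leq_trans (ltnW hi) (leq_Mprod_expn _ mB).
have k2 : 0 < 2 ^+ k :> R by rewrite exprn_gt0.
rewrite -mulrA ler_pdivlMl // ler_pdivlMr //.
move: lt; rewrite ltr_pdivlMr // => lt.
have {lt} := le_trans (ltW lt) lnn.
have k0 : 0 <= 2 ^+ k * k%:R :> R by rewrite mulr_ge0 // ltW.
have := ler_wpM2l k0 pn; rewrite natrM => le_phi lt.
apply: le_trans le_phi _; rewrite -(ler_pM2l (x := 3 * ln B%:R)) ?mulr_gt0 //.
rewrite (_ : _ * (2 ^+ k * _ * _) = 3 * ln B%:R * (k%:R * 2 ^+ k) * phi n); last by ring.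
by rewrite [leRHS]mulrAC.
Qed.

(** Several [k] may select the same level, so their weights are added. Stopping at k = N loses
    nothing when [k <= Nk k] for all [k]. *)
Definition selected_weight (Nk : nat -> nat) (N : nat) : R :=
  \sum_(k < N.+1) if Nk k == N then 2 ^- k else 0.

Lemma selected_weight_ge0 Nk N : 0 <= selected_weight Nk N.
Proof. by apply: sumr_ge0 => k _; case: ifP. Qed.

Lemma selected_weight_ge Nk k : (k <= Nk k)%N -> 2 ^- k <= selected_weight Nk (Nk k).
Proof.
move=> kN; rewrite /selected_weight (bigD1 (Ordinal (kN : (k < (Nk k).+1)%N))) //= eqxx.
by rewrite lerDl sumr_ge0 // => i _; case: ifP.
Qed.

Lemma sum_pow2_le n : \sum_(k < n) 2 ^- k <= 2 :> R.
Proof.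
suff -> : \sum_(k < n) 2 ^- k = 2 - 2 * 2 ^- n :> R.
  by have : 0 <= 2 ^- n :> R; [rewrite invr_ge0 exprn_ge0 | lra].
elim: n => [|n ih]; first by rewrite big_ord0 expr0 invr1 mulr1 subrr.
by rewrite big_ord_recr ih exprS /=; field; rewrite expf_neq0.
Qed.

(** After extending the inner range to [n] and exchanging the sums, each [k] is counted for at most
    one level. *)
Lemma selected_weight_sum Nk n : \sum_(N < n) selected_weight Nk N <= 2.
Proof.
apply: le_trans (sum_pow2_le n).
apply: (@le_trans _ _ (\sum_(N < n) \sum_(k < n) if Nk k == N then 2 ^- k else 0)).
  apply: ler_sum => N _; rewrite /selected_weight.
  rewrite -!(big_mkord predT (fun k => if Nk k == N then 2 ^- k else 0 : R)).
  rewrite [leRHS](big_cat_nat (n := N.+1)) //= lerDl sumr_ge0 // => k _.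
  by case: ifP.
rewrite exchange_big; apply: ler_sum => k _ /=.
rewrite -big_mkcond /=.
have [kn|kn] := ltnP (Nk k) n.
  by rewrite (big_pred1 (Ordinal kn)) // => N; rewrite -val_eqE eq_sym.
by rewrite big_pred0 // => N; rewrite gtn_eqF // (leq_trans (ltn_ord N)).
Qed.

End Choice.

Unset Implicit Arguments.
Local Open Scope complex_scope.

Theorem mainTheorem1 (R : realType) (m : nat -> nat)
    (m_ge2 : forall k : nat, (2 <= m k)%N)
    (m_bounded : exists B : nat, forall k : nat, (m k <= B)%N)
    (mu : probability (vilenkin m) R) (mu_haar : haar mu) :
  (exists c : R, forall f : nat -> vilenkin m -> R[i],
     hardy mu 1%E f ->
     (ereal_sup [set (n%:R * ln n%:R)^-1%:E *
                     \sum_(1 <= k < n.+1) cnorm mu 1 (mpsum mu f k)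
                 | n in [set n : nat | (2 <= n)%N]]
      <= c%:E * Hnorm mu 1 f)%E) /\
  (forall phi : nat -> R,
     (forall n : nat, (1 <= n)%N -> 1 <= phi n) ->
     (forall n k : nat, (1 <= n)%N -> (n <= k)%N -> phi n <= phi k) ->
     limn_esup (fun n : nat => (ln n%:R / phi n)%:E) = +oo%E ->
     exists f : nat -> vilenkin m -> R[i],
       hardy mu 1%E f /\
       ereal_sup [set ((n%:R * phi n)^-1%:E *
                      \sum_(1 <= k < n.+1) cnorm mu 1 (mpsum mu f k))%E
                  | n in [set n : nat | (1 <= n)%N]] = +oo%E).
Proof.
have [B mB] := m_bounded; split.
  exists ((B.+1 * 2)%:R / ln 2) => f [fM _].
  by apply: ub_ereal_sup => _ [n n2 <-]; exact: strong_mean_upper.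
move=> phi phi1 phi_mono phi_lim.
have [Nk Nk_ge Nk_phi] : exists2 Nk : nat -> nat, forall k, (k <= Nk k)%N &
    forall k, k%:R <= 2 ^- k * (Nk k)%:R / phi (2 * Mprod m (Nk k))%N.
  have /choice[Nk NkP] : forall k, exists N, (k <= N)%N /\
      k%:R <= 2 ^- k * N%:R / phi (2 * Mprod m N)%N.
    by move=> k; have [N] := growth_levels m_ge2 k mB phi1 phi_mono phi_lim; exists N.
  by exists Nk => k; have [] := NkP k.
pose lam : nat -> R := selected_weight R Nk.
have lam0 N : 0 <= lam N by exact: selected_weight_ge0.
have lam2 n : \sum_(N < n) lam N <= 2 by exact: selected_weight_sum.
exists (lacunary lam); split; first exact: lacunary_hardy.
apply/eqyP => A A0.
have B0 : (0 < B)%N by exact: leq_trans (m_gt0 m_ge2 0) (mB 0%N).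
(* With k >= 4B (A + 1), the lower bound at level [Nk k] is still at least [A] after division by 4B
   and the loss of 1. *)
pose k := (Num.truncn ((4 * B)%:R * (A + 1))).+1.
have kA : (4 * B)%:R * (A + 1) <= k%:R by apply: ltW; exact: truncnS_gt.
set N := Nk k; have M0 := Mprod_gt0 m_ge2 N.
have phiN : 1 <= phi (2 * Mprod m N)%N by apply: phi1; lia.
apply: (@le_trans _ _ (lam N * N%:R / phi (2 * Mprod m N)%N / (4 * B)%:R - 1)%:E).
  rewrite lee_fin lerBrDr ler_pdivlMr; last by rewrite ltr0n; lia.
  rewrite mulrC; apply: le_trans kA _; apply: le_trans (Nk_phi k) _.
  rewrite !ler_wpM2r // ?invr_ge0 ?(le_trans ler01) //.
  exact: selected_weight_ge.
apply: (le_trans (strong_mean_lower m_ge2 mu_haar lam0 lam2 N mB phiN)).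
by apply: ereal_sup_ubound; exists (2 * Mprod m N)%N => //=; lia.
Qed.
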